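(* Let $K\subset\mathbb{R}^d$ be a convex body with $K+\mathbb{Z}^d=\mathbb{R}^d$. Then there exists a polytopal tile $\Omega\subseteq K$.
   Context: A convex body in $\mathbb{R}^d$ is a non-empty compact convex set. A set is called polytopal if it is a finite union of convex polytopes. A tile is a (not necessarily convex) translative tile with respect to $\mathbb{Z}^d$, i.e. a set $\Omega\subset\mathbb{R}^d$ with $\Omega+\mathbb{Z}^d=\mathbb{R}^d$ such that the translates $\Omega+z$, $z\in\mathbb{Z}^d$, are non-overlapping (have pairwise disjoint interiors). *)

(* Defs.v *)
From mathcomp Require Import all_boot all_order all_algebra.
From mathcomp Require Import all_classical all_reals all_analysis.

Set Implicit Arguments.
Unset Strict Implicit.
Unset Printing Implicit Defensive.

Import Order.TTheory GRing.Theory Num.Theory.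
Import numFieldNormedType.Exports.

Local Open Scope classical_set_scope.
Local Open Scope ring_scope.

(* 'rV[R]_d carries the sup norm, which induces the usual topology of R^d. *)

Definition integer_lattice (R : realType) (d : nat) : set 'rV[R]_d :=
  [set z | forall i, z 0 i \is a Num.int].

Arguments integer_lattice R d : clear implicits.

Definition minkowski_sum (R : realType) (d : nat) (A B : set 'rV[R]_d) :
    set 'rV[R]_d :=
  [set x + y | x in A & y in B].

Definition translate (R : realType) (d : nat) (A : set 'rV[R]_d)
    (z : 'rV[R]_d) : set 'rV[R]_d :=
  [set x + z | x in A].

Definition convex_body (R : realType) (d : nat) (K : set 'rV[R]_d) : Prop :=
  [/\ K !=set0, compact K & convex_set (K : set (convex_lmodType 'rV[R]_d))].

Definition convex_hull (R : realType) (d : nat) (A : set 'rV[R]_d) :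
    set 'rV[R]_d :=
  smallest (@convex_set R 'rV[R]_d) A.

(* The empty polytope is allowed; this does not change which nonempty sets are
   finite unions of polytopes. *)
Definition convex_polytope (R : realType) (d : nat) (P : set 'rV[R]_d) : Prop :=
  exists2 V : set 'rV[R]_d, finite_set V & P = convex_hull V.

Definition polytopal (R : realType) (d : nat) (A : set 'rV[R]_d) : Prop :=
  exists F : set (set 'rV[R]_d),
    [/\ finite_set F, F `<=` @convex_polytope R d & A = \bigcup_(P in F) P].

Definition translative_tile (R : realType) (d : nat) (Omega : set 'rV[R]_d) :
    Prop :=
  minkowski_sum Omega (integer_lattice R d) = [set: 'rV[R]_d] /\
  trivIset (integer_lattice R d) (fun z => interior (translate Omega z)).

(* Main.v *)
Require Import Defs.
From mathcomp Require Import all_boot all_order all_algebra.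
From mathcomp Require Import all_classical all_reals all_analysis.
From mathcomp Require Import ring lra zify.
Import Order.TTheory GRing.Theory Num.Theory.
Import numFieldNormedType.Exports.
Local Open Scope classical_set_scope.
Local Open Scope ring_scope.

Set Implicit Arguments.
Unset Strict Implicit.
Unset Printing Implicit Defensive.

(* Only finitely many lattice translates of K meet the unit cube, and these
   closed convex sets cover it.  The key fact is that whenever finitely many
   closed convex sets cover a box, finitely many hyperplanes cut the box into
   cells each contained in one of the sets.  This goes by induction on the
   dimension of the box: around a point x take a box so small that it meets only
   those sets that contain x; dissect its facets by induction; since the sets
   are convex and contain x, the cones with apex x over the cells of the facets
   stay inside the sets.  Compactness makes this global.  Applied to the cube,
   each cell Q lies in K + z for some lattice vector z = z(Q), and the union of
   the polytopes Q - z(Q) is the tile: it is a dissection of the unit cube whose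
   pieces have been moved by lattice vectors. *)

(** * Affine forms, sign cells and boxes *)

Section AffineForms.
Variables (R : realType) (d : nat).
Implicit Types (x y z l : 'rV[R]_d) (h : 'rV[R]_d * R) (H : seq ('rV[R]_d * R)).

Definition dot l x : R := \sum_i l 0 i * x 0 i.

Lemma dotDr l x y : dot l (x + y) = dot l x + dot l y.
Proof. by rewrite /dot -big_split; apply: eq_bigr => i _; rewrite mxE mulrDr. Qed.

Lemma dotZr l t x : dot l (t *: x) = t * dot l x.
Proof. by rewrite /dot mulr_sumr; apply: eq_bigr => i _; rewrite mxE mulrCA. Qed.

Lemma dotNr l x : dot l (- x) = - dot l x.
Proof. by rewrite -scaleN1r dotZr mulN1r. Qed.

Lemma dotC l x : dot l x = dot x l.
Proof. by apply: eq_bigr => i _; rewrite mulrC. Qed.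

Lemma dotDl l m x : dot (l + m) x = dot l x + dot m x.
Proof. by rewrite dotC dotDr !(dotC x). Qed.

Lemma dotZl t l x : dot (t *: l) x = t * dot l x.
Proof. by rewrite dotC dotZr dotC. Qed.

Lemma dotNl l x : dot (- l) x = - dot l x.
Proof. by rewrite dotC dotNr dotC. Qed.

Lemma dot_delta i x : dot (delta_mx 0 i) x = x 0 i.
Proof.
rewrite /dot (bigD1 i)//= !mxE !eqxx mul1r big1 ?addr0// => j ji.
by rewrite mxE (negPf ji) andbF mul0r.
Qed.

Definition aeval h x : R := dot h.1 x + h.2.

Lemma aeval_line h x y t :
  aeval h (x + t *: (y - x)) = aeval h x + t * (aeval h y - aeval h x).
Proof. by rewrite /aeval dotDr dotZr dotDr dotNr; ring. Qed.

Lemma aeval_continuous h : continuous (aeval h : 'rV[R]_d -> R).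
Proof.
have dotc : continuous (dot h.1 : 'rV[R]_d -> R).
  move=> x; apply: cvg_big; [exact: (@add_continuous R) | exact: nbhs_filter | ].
  move=> i _; have xi := @coord_continuous R 1 d 0 i x.
  exact: (@cvgM _ _ _ _ (fun=> h.1 0 i) (fun y : 'rV[R]_d => y 0 i) _ _ (cvg_cst _) xi).
by move=> x; apply: (cvgD (dotc x) (cvg_cst _)).
Qed.

(** Both sides are closed, so cells may share boundary points, and the cells of all sign patterns
    cover the space. Only the values of [s] on [H] matter. *)
Definition cell H (s : 'rV[R]_d * R -> bool) : set 'rV[R]_d :=
  [set x | forall h, h \in H -> if s h then 0 <= aeval h x else aeval h x <= 0].

Definition box (a b : 'rV[R]_d) : set 'rV[R]_d :=
  [set x | forall i, a 0 i <= x 0 i <= b 0 i].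

Definition centered l x : 'rV[R]_d * R := (l, - dot l x).

Lemma aeval_centered l x y : aeval (centered l x) y = dot l (y - x).
Proof. by rewrite /aeval dotDr dotNr. Qed.

Lemma box_compact a b : compact (box a b).
Proof.
rewrite (_ : box a b =
  [set v : 'rV[R]_d | forall i, `[a 0 i, b 0 i]%classic (v ord0 i)]).
  by apply: (@rV_compact _ _ (fun i => `[a 0 i, b 0 i]%classic)) => i;
     exact: segment_compact.
by apply/seteqP; split=> x /= xab i; have := xab i; rewrite in_itv.
Qed.

End AffineForms.

Lemma convex_setP (R : realType) (d : nat) (A : set 'rV[R]_d) :
  convex_set (A : set (convex_lmodType 'rV[R]_d)) <->
  forall x y t, 0 <= t -> t <= 1 -> A x -> A y -> A (x + t *: (y - x)).
Proof.
split=> [cA x y t t0 t1 Ax Ay|cA x y t /set_mem Ax /set_mem Ay].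
  have := cA y x (Itv01 t0 t1) (mem_set Ay) (mem_set Ax).
  move=> /set_mem; congr A; change (t *: y + (1 - t) *: x = x + t *: (y - x)).
  by rewrite scalerBl scale1r scalerBr addrCA addrC.
apply/mem_set; change (A (t%:num *: x + (1 - t%:num) *: y)).
suff -> : t%:num *: x + (1 - t%:num) *: y = y + t%:num *: (x - y) by exact: cA.
by rewrite scalerBr scalerBl scale1r addrCA.
Qed.

(** * Dissections of boxes adapted to a cover by closed convex sets *)

Section Dissection.
Variables (R : realType) (d : nat) (J : finType).
Implicit Types (a b x y : 'rV[R]_d) (C : J -> set 'rV[R]_d) (Q : set 'rV[R]_d).

(** Even a cell missing [Q] must receive an index, which is why an element of [J] is assumed
    below. *)
Definition dissected Q C := exists H : seq ('rV[R]_d * R),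
  forall s, exists j, Q `&` cell H s `<=` C j.

(** Facets missing [x] suffice: a ray from [x] running through the box exits through such a facet at
    a point [w], and if [w] is in [C j], so is the segment from [x] to [w], by convexity. *)
Lemma cone_dissected a b x C : box a b x ->
    (forall j, convex_set (C j : set (convex_lmodType 'rV[R]_d))) ->
    (forall j, C j x) -> J ->
    (forall i c, (c = a 0 i) \/ (c = b 0 i) -> c != x 0 i ->
      dissected (box a b `&` [set y | y 0 i = c]) C) ->
  dissected (box a b) C.
Proof.
move=> abx Ccvx Cx j0 facet.
(* [(i, u)] indexes the facet of the box where coordinate [i] equals [c (i, u)].
   The linear form [lam p] of [y - x] is 1 on facet [p]; it vanishes
   identically ([0^-1 = 0]) when facet [p] contains [x]. The ray from [x] through
   [y] leaves the box through the facet for which [lam p] is maximal at [y], and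
   the hyperplanes [lam p = lam q] make that facet constant on each cell. *)
pose c (p : 'I_d * bool) := if p.2 then b 0 p.1 else a 0 p.1.
pose e p := (c p - x 0 p.1)^-1.
pose lam p : 'rV[R]_d := e p *: delta_mx 0 p.1.
have lamE p y : dot (lam p) (y - x) = (y 0 p.1 - x 0 p.1) / (c p - x 0 p.1).
  by rewrite /lam dotZl dot_delta !mxE mulrC.
have /choice[Hf HfP] p : exists H, c p != x 0 p.1 -> forall s, exists j,
    (box a b `&` [set y | y 0 p.1 = c p]) `&` cell H s `<=` C j.
  have [|cx] := boolP (c p == x 0 p.1); first by exists [::].
  have [|H HP] := facet p.1 (c p) _ cx; last by exists H.
  by rewrite /c; case: p.2; [right|left].
(* Agrees with [h] on facet [p] and is homogeneous about [x]. *)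
pose cone p (h : 'rV[R]_d * R) := centered (h.1 + aeval h x *: lam p) x.
pose H := [seq centered (lam pq.1 - lam pq.2) x | pq : ('I_d * bool) * ('I_d * bool)]
  ++ flatten [seq [seq cone p h | h <- Hf p] | p : 'I_d * bool].
exists H => s.
(* A cell with no point of the box other than [x] fits in any [C j]. Otherwise [y0] certifies that
   the maximal form is not identically zero. *)
have [[y0 [aby0 cy0 y0x]]|none] :=
    pselect (exists y0, [/\ box a b y0, cell H s y0 & y0 != x]); last first.
  exists j0 => y [aby cy]; have [->//|yx] := eqVneq y x.
  by case: none; exists y.
have lam_pos y : box a b y -> y != x -> exists p, 0 < dot (lam p) (y - x).
  move=> aby yx; have {yx}[i yxi] : exists i, y 0 i != x 0 i.
    apply: contrapT => /forallNP yx'; move/eqP: yx; apply; apply/rowP => i.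
    by apply/eqP; rewrite -[_ == _]negbK; apply/negP/yx'.
  have /andP[ay yb] := aby i; move: yxi; rewrite neq_lt => /orP[yx|xy].
    exists (i, false); rewrite lamE /c/= -mulrNN -invrN !opprB divr_gt0// subr_gt0//.
    exact: le_lt_trans yx.
  by exists (i, true); rewrite lamE /c/= divr_gt0// subr_gt0//; exact: lt_le_trans yb.
have [p0 _] := lam_pos _ aby0 y0x.
(* Compares two forms on the whole cell. As [H] contains their centered difference, any two are
   comparable, so a single facet is maximal throughout the cell. *)
pose ord p q := `[< forall y, box a b y -> cell H s y ->
   dot (lam q) (y - x) <= dot (lam p) (y - x) >].
have ord_refl : reflexive ord by move=> p; apply/asboolP.
have ord_trans : transitive ord.
  move=> p q r /asboolP qp /asboolP pr; apply/asboolP => y aby cy.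
  exact: le_trans (pr _ aby cy) (qp _ aby cy).
have ord_total : total ord.
  move=> p q; have hH : centered (lam p - lam q) x \in H.
    by rewrite mem_cat; apply/orP; left; apply/mapP; exists (p, q); rewrite ?mem_enum.
  case: (boolP (s (centered (lam p - lam q) x))) => sh; apply/orP; [left|right];
    apply/asboolP => y aby /(_ _ hH); rewrite ?sh ?(negPf sh) aeval_centered dotDl dotNl.
    by rewrite subr_ge0.
  by rewrite subr_le0.
case: (@extremumP _ _ ord p0 xpredT id ord_refl ord_trans ord_total isT) => p _ pmax.
have {pmax}lam_max q y : box a b y -> cell H s y ->
    dot (lam q) (y - x) <= dot (lam p) (y - x).
  by move=> aby cy; move: (pmax q isT) => /asboolP; exact.
have {}lam_pos y : box a b y -> cell H s y -> y != x -> 0 < dot (lam p) (y - x).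
  move=> aby cy /(lam_pos _ aby)[q qy]; exact: lt_le_trans (lam_max q _ aby cy).
have cpx : c p != x 0 p.1.
  apply: contraTneq (lam_pos _ aby0 cy0 y0x) => cpx.
  by rewrite lamE cpx subrr invr0 mulr0 ltxx.
have [j jP] := HfP p cpx (s \o cone p).
exists j => y [aby cy]; have [->//|yx] := eqVneq y x.
have mu0 := lam_pos _ aby cy yx; set mu := dot _ _ in mu0.
have muE : mu = (y 0 p.1 - x 0 p.1) / (c p - x 0 p.1) by rewrite /mu lamE.
(* The exit point of the ray from [x] through [y]; as [0 < mu <= 1], [y] lies on the segment from
   [x] to [w]. *)
pose w := x + mu^-1 *: (y - x).
have wE i : w 0 i = x 0 i + (y 0 i - x 0 i) / mu by rewrite /w !mxE mulrC.
have mu1 : mu <= 1.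
  have /andP[ay yb] := aby p.1; have /andP[ax xb] := abx p.1.
  move: cpx; rewrite muE /c; case: p.2; rewrite neq_lt => /orP[cx|cx].
  - by move: xb; rewrite leNgt cx.
  - by rewrite ler_pdivrMr ?mul1r ?lerD2r// subr_gt0.
  - by rewrite ler_ndivrMr ?mul1r ?lerD2r// subr_lt0.
  - by move: ax; rewrite leNgt cx.
have Cw : C j w.
  apply: jP; split; first split.
  - move=> i; have /andP[ay yb] := aby i; have /andP[ax xb] := abx i.
    (* Maximality of [mu] against the facet towards which the ray moves in direction [i] keeps [w]
       in the box in that coordinate. *)
    rewrite wE; have [yx'|xy|->] := ltgtP (y 0 i) (x 0 i); last by rewrite subrr mul0r addr0 ax.
      have := lam_max (i, false) y aby cy; rewrite lamE /c/= -/mu.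
      have ax' : a 0 i < x 0 i by exact: le_lt_trans yx'.
      rewrite ler_ndivrMr ?subr_lt0// => le.
      apply/andP; split.
        by rewrite -lerBlDl ler_pdivlMr// mulrC.
      apply: le_trans xb; rewrite gerDl; apply: mulr_le0_ge0; last by rewrite invr_ge0 ltW.
      by rewrite subr_le0 ltW.
    have := lam_max (i, true) y aby cy; rewrite lamE /c/= -/mu.
    have xb' : x 0 i < b 0 i by exact: lt_le_trans yb.
    rewrite ler_pdivrMr ?subr_gt0// => le.
    apply/andP; split; last by rewrite -lerBrDl ler_pdivrMr// mulrC.
    apply: le_trans ax _; rewrite lerDl; apply: mulr_ge0; last by rewrite invr_ge0 ltW.
    by rewrite subr_ge0 ltW.
  - rewrite /= wE muE invf_div mulrCA divff ?mulr1 ?subrKC// subr_eq0.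
    apply: contraTneq mu0 => yxp; by rewrite muE yxp subrr mul0r ltxx.
  - move=> h hH; have cH : cone p h \in H.
      rewrite mem_cat; apply/orP; right; apply/flatten_mapP; exists p; rewrite ?mem_enum//.
      by apply: map_f.
    have := cy _ cH; rewrite /= /w aeval_line.
    have -> : aeval h x + mu^-1 * (aeval h y - aeval h x) = mu^-1 * aeval (cone p h) y.
      rewrite /cone aeval_centered dotDl dotZl -/mu /aeval dotDr dotNr.
      by field; rewrite gt_eqF.
    by case: ifP => _; rewrite ?pmulr_rge0 ?pmulr_rle0 ?invr_gt0.
rewrite (_ : y = x + mu *: (w - x)); last first.
  by rewrite /w addrAC subrr add0r scalerA divff ?gt_eqF// scale1r subrKC.
by apply: (convex_setP (C j)).1 => //; exact: ltW.
Qed.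

Lemma cell_subseq (H H' : seq ('rV[R]_d * R)) s :
  {subset H' <= H} -> cell H s `<=` cell H' s.
Proof. by move=> H'H x cx h /H'H /cx. Qed.

(** By compactness finitely many local boxes cover. Adding their walls to the hyperplanes confines
    every cell with a point strictly inside a local box to that box. *)
Lemma local_dissected a b C : J ->
    (forall x, box a b x -> exists2 e, 0 < e &
      dissected (box a b `&` box (x - const_mx e) (x + const_mx e)) C) ->
  dissected (box a b) C.
Proof.
move=> j0 loc.
have /choice[eH eHP] x : exists eH : R * seq ('rV[R]_d * R), box a b x ->
    0 < eH.1 /\ forall s, exists j,
    (box a b `&` box (x - const_mx eH.1) (x + const_mx eH.1)) `&` cell eH.2 s `<=` C j.
  have [/loc[e e0 [H HP]]|nx] := pselect (box a b x); first by exists (e, H).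
  by exists (0, [::]).
have := @box_compact R d a b; rewrite compact_cover => /(_ _ (box a b)
  (fun x => ball x (eH x).1)) [|x abx|D' D'ab cov].
- by move=> x _; exact: ball_open.
- by exists x => //; apply: ballxx; case: (eHP _ abx).
pose wall x (p : 'I_d * bool) : 'rV[R]_d * R :=
  (delta_mx 0 p.1, - (x 0 p.1 + (if p.2 then (eH x).1 else - (eH x).1))).
have wallE x i u y : aeval (wall x (i, u)) y
    = y 0 i - (x 0 i + (if u then (eH x).1 else - (eH x).1)).
  by rewrite /aeval dot_delta.
pose HH x := (eH x).2 ++ [seq wall x p | p : 'I_d * bool].
exists (flatten [seq HH x | x <- finmap.enum_fset D']) => s.
set H := flatten _.
have [[y [aby cy]]|none] := pselect (exists y, box a b y /\ cell H s y); last first.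
  by exists j0 => y [aby cy]; case: none; exists y.
have [x xD' xy] := cov _ aby; have abx : box a b x by apply/set_mem/D'ab.
have [e0 /(_ s)[j jP]] := eHP _ abx; exists j => z [abz cz].
have HHx : {subset HH x <= H} by move=> h hx; apply/flatten_mapP; exists x.
have {}cy := cell_subseq HHx cy; have {}cz := cell_subseq HHx cz.
apply: jP; split; last by apply: cell_subseq cz => h hx; rewrite mem_cat hx.
split=> // i; rewrite !mxE.
have wH u : wall x (i, u) \in HH x.
  by rewrite mem_cat; apply/orP; right; apply/mapP; exists (i, u); rewrite ?mem_enum.
case: xy => _ /(_ 0 i); rewrite /ball/= ltr_norml => /andP[yl yu].
apply/andP; split.
  have := cy _ (wH false); have := cz _ (wH false); rewrite !wallE.
  by case: ifP => _ zi yi; lra.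
have := cy _ (wH true); have := cz _ (wH true); rewrite !wallE.
by case: ifP => _ zi yi; lra.
Qed.

Lemma dissected_comp Q C (f : J -> J) :
  dissected Q (C \o f) -> dissected Q C.
Proof. by move=> [H HP]; exists H => s; have [j jP] := HP s; exists (f j). Qed.

(** The members missing [x] are closed and finitely many, so some ball around [x] avoids them all;
    half its radius gives a closed box inside it. *)
Lemma near_closed_family C x : (forall j, closed (C j)) ->
  exists2 e, 0 < e &
    forall y j, box (x - const_mx e) (x + const_mx e) y -> C j y -> C j x.
Proof.
move=> Ccl.
have : \forall y \near x, forall j, C j y -> C j x.
  apply: (filter_forall (nbhs_filter x)) => j; have [Cx|nCx] := pselect (C j x).
    by near=> y.
  have : nbhs x (~` C j) by apply: open_nbhs_nbhs; split => //; exact: closed_openC.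
  by apply: filterS.
move=> /nbhs_ballP[e /= e0 xe]; exists (e / 2); first by rewrite divr_gt0.
move=> y j xy; apply: xe; split=> // i k; rewrite (ord1 i) /ball/=.
by have := xy k; rewrite !mxE ltr_norml => /andP[yl yu]; apply/andP; split; lra.
Unshelve. all: by end_near.
Qed.

(** Dimension is counted by non-degenerate coordinates, so a facet is again a box in the same
    ambient space, with one coordinate frozen. *)
Lemma box_dissected n a b C : (#|[pred i | (a 0 i != b 0 i)%R]| < n)%N ->
    (forall j, closed (C j)) ->
    (forall j, convex_set (C j : set (convex_lmodType 'rV[R]_d))) -> J ->
    box a b `<=` \bigcup_j C j ->
  dissected (box a b) C.
Proof.
elim: n a b C => // n IHn a b C abn Ccl Ccvx j0 cov.
apply: local_dissected => // x abx.
have [e e0 eP] := near_closed_family x Ccl; exists e => //.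
have [jx _ Cjx] := cov _ abx.
(* Sets missing [x] do not meet the small box, so they may be replaced. *)
pose f j := if `[< C j x >] then j else jx.
have fx j : C (f j) x by rewrite /f; case: asboolP.
apply: (@dissected_comp _ _ f).
pose a' : 'rV[R]_d := \row_i Num.max (a 0 i) (x 0 i - e).
pose b' : 'rV[R]_d := \row_i Num.min (b 0 i) (x 0 i + e).
have a'E i : a' 0 i = Num.max (a 0 i) (x 0 i - e) by rewrite /a' mxE.
have b'E i : b' 0 i = Num.min (b 0 i) (x 0 i + e) by rewrite /b' mxE.
have -> : box a b `&` box (x - const_mx e) (x + const_mx e) = box a' b'.
  apply/seteqP; split=> y /=.
    move=> [aby xy] i; have := aby i; have := xy i; rewrite !mxE ?updE ?a'E ?b'E ge_max le_min.
    by move=> /andP[-> ->] /andP[-> ->].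
  move=> aby; split=> i; have := aby i; rewrite !mxE ?updE ?a'E ?b'E ge_max le_min;
  by move=> /andP[/andP[al xl] /andP[ub xu]]; apply/andP.
have abx' : box a' b' x.
  move=> i; have /andP[ax xb] := abx i; rewrite !mxE ?updE ?a'E ?b'E ge_max le_min ax xb.
  by apply/andP; split; lra.
apply: (@cone_dissected _ _ _ (C \o f) abx' _ fx jx).
  by move=> j; exact: Ccvx.
move=> i c cab cx.
pose upd (v : 'rV[R]_d) : 'rV[R]_d := \row_k if k == i then c else v 0 k.
have updE v k : upd v 0 k = if k == i then c else v 0 k by rewrite /upd mxE.
have ab'i : a' 0 i <= b' 0 i by have /andP[] := abx' i; exact: le_trans.
have ab'c : a' 0 i <= c <= b' 0 i by case: cab => ->; rewrite lexx ab'i.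
have -> : box a' b' `&` [set y | y 0 i = c] = box (upd a') (upd b').
  apply/seteqP; split=> y /=.
    move=> [aby yi] k; rewrite !updE.
    by case: eqP => [->|_]; [rewrite yi lexx | exact: aby].
  move=> aby; have yi : y 0 i = c.
    by have := aby i; rewrite !updE eqxx -eq_le => /eqP.
  split=> // k; have := aby k; rewrite !updE.
  by case: eqP => [->|//]; rewrite yi.
apply: IHn => //.
(* Degenerate coordinates stay so, and coordinate [i] becomes degenerate; it was not before, since
   [c] and [x 0 i] are distinct values in its range. *)
- rewrite -ltnS; apply: leq_trans abn; rewrite ltnS; apply: proper_card.
  apply/properP; split.
    apply/fintype.subsetP => k; rewrite !inE !mxE ?updE ?a'E ?b'E.
    have [->|_] := eqVneq k i; first by rewrite eqxx.
    apply: contraNneq => abk; have := abx' k; have := abx k; rewrite !mxE ?updE ?a'E ?b'E abk.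
    move=> /andP[kx xk]; have -> : x 0 k = b 0 k by apply/eqP; rewrite eq_le kx xk.
    by rewrite max_l ?min_l //; lra.
  exists i; rewrite !inE ?mxE ?eqxx//.
  apply: contraNneq cx => abi; have := abx' i; have := ab'c; rewrite !mxE ?updE ?a'E ?b'E abi.
  move=> /andP[ac cb] /andP[ax xb]; have /andP[ax' xb'] := abx i.
  move: ac cb ax xb; rewrite !ge_max !le_min => /andP[? _] /andP[? _] _ _.
  by rewrite abi in ax' *; apply/eqP; lra.
- by move=> j; exact: Ccl.
- by move=> j; exact: Ccvx.
move=> y aby.
have {}aby : box a' b' y.
  move=> k; have := aby k; rewrite !updE.
  by case: eqP => [-> /(andP)[cy yc]|//]; have -> : y 0 i = c by lra.
have [j _ Cy] : (\bigcup_j C j) y.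
  apply: cov => k; have := aby k; rewrite !mxE ?updE ?a'E ?b'E ge_max le_min.
  by move=> /andP[/andP[al _] /andP[ub _]]; apply/andP.
(* By the choice of [e], a set reaching the small box contains [x], so [f] fixes its index. *)
have Cjx' : C j x.
  apply: (eP y) => // k; have := aby k; rewrite !mxE ?updE ?a'E ?b'E ge_max le_min.
  by move=> /andP[/andP[_ xl] /andP[_ xu]]; apply/andP.
by exists j => //=; rewrite /f asboolT.
Qed.

End Dissection.

(** * Bounded polyhedra as convex hulls of finitely many vertices *)

Section Polyhedron.
Variables (R : realType) (d : nat) (I : finType) (g : I -> 'rV[R]_d * R).
Implicit Types (a b x y u : 'rV[R]_d).

Definition polyhedron : set 'rV[R]_d := [set x | forall i, 0 <= aeval (g i) x].

Let active x := [set i | aeval (g i) x == 0]%SET.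

(** Active constraints stay zero along [u]. Boundedness forces some constraint to decrease; stopping
    when the first one reaches zero makes it active too. *)
Lemma polyhedron_exit a b x u : polyhedron `<=` box a b -> polyhedron x ->
    u != 0 -> (forall i, i \in active x -> dot (g i).1 u = 0) ->
  exists t, [/\ 0 < t, polyhedron (x + t *: u) & active x \proper active (x + t *: u)].
Proof.
move=> Qab Qx u0 uact.
have gE i t : aeval (g i) (x + t *: u) = aeval (g i) x + t * dot (g i).1 u.
  by rewrite /aeval dotDr dotZr addrAC.
have [i0 i0P] : exists i, dot (g i).1 u < 0.
  apply: contrapT => /forallNP nneg.
  have Qt t : 0 <= t -> polyhedron (x + t *: u).
    move=> t0 i; rewrite gE addr_ge0// mulr_ge0// leNgt; exact/negP/nneg.
  have [k uk] : exists k, u 0 k != 0.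
    apply: contrapT => /forallNP uk; move/eqP: u0; apply; apply/rowP => k.
    by rewrite mxE; apply/eqP; rewrite -[_ == _]negbK; apply/negP/uk.
  have /andP[ax xb] := Qab _ Qx k.
  (* In this time coordinate [k] moves by more than the width of the box. *)
  have t0 : 0 <= (b 0 k - a 0 k + 1) / `|u 0 k|.
    by rewrite divr_ge0// addr_ge0// subr_ge0; exact: le_trans xb.
  have := Qab _ (Qt _ t0) k; rewrite !mxE.
  have [up|un|u00] := ltgtP 0 (u 0 k); last by rewrite -u00 eqxx in uk.
    by rewrite gtr0_norm// divfK ?gt_eqF// => /andP[_]; lra.
  by rewrite ltr0_norm// invrN mulrN mulNr divfK ?lt_eqF// => /andP[]; lra.
pose ratio i := aeval (g i) x / - dot (g i).1 u.
case: (@arg_minP _ R I i0 (fun i => dot (g i).1 u < 0) ratio i0P) => i iP imin.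
have ri0 : 0 < ratio i.
  rewrite divr_gt0 ?oppr_gt0// lt_neqAle eq_sym Qx andbT.
  by apply: contraTN iP => gi; rewrite uact ?ltxx// inE.
exists (ratio i); split=> //.
  move=> k; rewrite gE; have [kn|kp] := ltP (dot (g k).1 u) 0; last first.
    by rewrite addr_ge0// mulr_ge0// ltW.
  have : ratio i <= aeval (g k) x / - dot (g k).1 u := imin k kn.
  by rewrite ler_pdivlMr ?oppr_gt0// mulrN; lra.
apply/properP; split.
  apply/fintype.subsetP => k kx; move: (kx); rewrite !inE gE uact// mulr0 addr0.
  by move=> ->.
exists i; rewrite !inE ?gE.
  by apply/eqP; rewrite /ratio; field; rewrite lt_eqF.
by apply: contraTN iP => gi; rewrite uact ?ltxx// inE.
Qed.

Lemma convex_polyhedron :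
  convex_set (polyhedron : set (convex_lmodType 'rV[R]_d)).
Proof.
apply/convex_setP => x y t t0 t1 Qx Qy i; rewrite aeval_line.
rewrite (_ : _ + _ = (1 - t) * aeval (g i) x + t * aeval (g i) y); last by ring.
by rewrite addr_ge0// mulr_ge0// subr_ge0.
Qed.

(** Induction on the number of inactive constraints: a non-vertex lies between the two exit points
    of a line through it, and both have more active constraints. *)
Lemma polyhedron_polytope a b : polyhedron `<=` box a b ->
  convex_polytope polyhedron.
Proof.
move=> Qab.
(* The vertices are the points whose set of active constraints determines them. *)
pose V := [set x | polyhedron x /\
  forall y, polyhedron y -> active x \subset active y -> y = x].
exists V.
  (* A vertex is recovered from its active set, and there are finitely many such sets. *)
  apply: (@sub_finite_set _ _
    ((fun A : {set I} => xget 0 [set x | polyhedron x /\ active x = A]) @` setT)).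
    move=> x [Qx xmax]; exists (active x) => //.
    case: xgetP => [y _ [Qy yx]|/(_ x)]; last by case.
    by apply: xmax => //; rewrite yx.
  by apply: finite_image; exact: finite_finset.
apply/seteqP; split=> [x Qx|]; last first.
  apply: smallest_sub; first exact: convex_polyhedron.
  by move=> x [].
move=> C [Ccvx VC].
have [n] := ubnP #|~: active x|; elim: n x Qx => // n IHn x Qx xn.
have [Vx|nVx] := pselect (V x); first exact: VC.
have [y [Qy xy yx]] : exists y, [/\ polyhedron y, active x \subset active y & y <> x].
  apply: contrapT => /forallNP ny; apply: nVx; split => // y Qy xy.
  by apply: contrapT => yx; apply: (ny y).
have u0 : y - x != 0 by rewrite subr_eq0; exact/eqP.
have uact i : i \in active x -> dot (g i).1 (y - x) = 0.
  move=> ix; have := fintype.subsetP xy _ ix; move: ix; rewrite !inE /aeval dotDr dotNr.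
  by move=> /eqP gx /eqP gy; lra.
have IH z : polyhedron z -> active x \proper active z -> C z.
  move=> Qz xz; apply: IHn => //; rewrite -ltnS; apply: leq_trans xn.
  by rewrite ltnS; apply: proper_card; rewrite properC.
have [t [t0 Qt xt]] := polyhedron_exit Qab Qx u0 uact.
have [||r [r0 Qr xr]] := @polyhedron_exit a b x (- (y - x)) Qab Qx.
- by rewrite oppr_eq0.
- by move=> i /uact; rewrite dotNr => ->; rewrite oppr0.
have tr0 : 0 < r + t by exact: addr_gt0.
rewrite (_ : x = (x + r *: - (y - x)) +
   (r / (r + t)) *: ((x + t *: (y - x)) - (x + r *: - (y - x)))); last first.
  rewrite scalerN opprD opprK addrACA subrr add0r -scalerDl scalerA (addrC t).
  by rewrite divfK ?gt_eqF// subrK.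
apply: (convex_setP C).1 => //.
- by rewrite divr_ge0// ltW.
- by rewrite ler_pdivrMr// mul1r lerDl ltW.
- exact: IH.
- exact: IH.
Qed.

End Polyhedron.

(** * Polytopal pieces and generic points *)

Section Pieces.
Variables (R : realType) (d : nat).
Implicit Types (a b x y z w p : 'rV[R]_d) (W : set 'rV[R]_d).
Implicit Types (h : 'rV[R]_d * R) (H : seq ('rV[R]_d * R)).

Definition shift_form h z : 'rV[R]_d * R := (h.1, h.2 + dot h.1 z).

Lemma aeval_shift h z x : aeval (shift_form h z) x = aeval h (x + z).
Proof. by rewrite /aeval dotDr addrAC addrA. Qed.

Definition opp_form h : 'rV[R]_d * R := (- h.1, - h.2).

Lemma aeval_opp h x : aeval (opp_form h) x = - aeval h x.
Proof. by rewrite /aeval dotNl opprD. Qed.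

Definition piece a b H s z := [set x | box a b (x + z) /\ cell H s (x + z)].

Lemma piece_polytope a b H s z : convex_polytope (piece a b H s z).
Proof.
pose coord i c : 'rV[R]_d * R := (delta_mx 0 i, c).
have coordE i c x : aeval (coord i c) x = x 0 i + c.
  by rewrite /aeval dot_delta.
pose g (k : 'I_d + 'I_d + 'I_(size H)) := shift_form
  match k with
  | inl (inl i) => coord i (- a 0 i)
  | inl (inr i) => opp_form (coord i (- b 0 i))
  | inr k => let h := tnth (in_tuple H) k in if s h then h else opp_form h
  end z.
have gP : piece a b H s z = polyhedron g.
  apply/seteqP; split=> x /=.
    move=> [abx cx] [[i|i]|k]; rewrite aeval_shift ?aeval_opp ?coordE.
    - by rewrite subr_ge0; have /andP[] := abx i.
    - by rewrite oppr_ge0 subr_le0; have /andP[] := abx i.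
    - have := cx _ (mem_tnth k (in_tuple H)); rewrite /=; case: ifP => // _.
      by rewrite aeval_opp oppr_ge0.
  move=> gx; split.
    move=> i; have := gx (inl (inl i)); have := gx (inl (inr i)).
    rewrite !aeval_shift aeval_opp !coordE oppr_ge0 subr_le0 subr_ge0.
    by move=> -> ->.
  move=> h /(tnthP (in_tuple H))[k ->]; have := gx (inr k); rewrite aeval_shift /=.
  by case: ifP => // _; rewrite aeval_opp oppr_ge0.
rewrite gP; apply: (@polyhedron_polytope _ _ _ _ (a - z) (b - z)).
rewrite -gP => x [abx _] i; have := abx i; rewrite !mxE.
by rewrite lerBlDr lerBrDr.
Qed.

Lemma open_segment W w p : open W -> W w ->
  exists2 t, 0 < t <= 1 & W (w + t *: (p - w)).
Proof.
move=> Wo Ww; have /nbhs_ballP[e /= e0 eW] : nbhs w W by exact: open_nbhs_nbhs.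
pose N := 1 + `|p - w|; have N0 : 0 < N by rewrite ltr_pwDl.
exists (Num.min 1 (e / 2 / N)).
  by rewrite lt_min ltr01 ge_min lexx !divr_gt0.
apply: eW; rewrite -ball_normE /ball_/= opprD addrA subrr sub0r normrN normrZ.
set t := Num.min _ _.
have t0 : 0 <= t by rewrite le_min ler01 !divr_ge0 // ltW.
have tN : t * N <= e / 2 by rewrite -ler_pdivlMr// ge_min lexx orbT.
rewrite ger0_norm//; apply: le_lt_trans (_ : _ <= t * N) _.
  by rewrite ler_wpM2l// lerDr.
by apply: le_lt_trans tN _; lra.
Qed.

(** A short step from a point of a hyperplane towards a point off it leaves the hyperplane but not
    [W]. What remains of [W] is open, so the forms are treated one by one. *)
Lemma generic_point W H : open W -> W !=set0 ->
    (forall h, h \in H -> exists x, aeval h x != 0) ->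
  exists2 w, W w & forall h, h \in H -> aeval h w != 0.
Proof.
elim: H W => [|h H IH] W Wo [w Ww] Hn0; first by exists w.
have [||k kH|v [Wv hv] vH] := IH (W `&` [set x | aeval h x != 0]).
- apply: openI => //; apply: (@open_comp _ _ (aeval h) [set r | r != 0]).
    by move=> x _; exact: aeval_continuous.
  exact: open_neq.
- have [|hw] := boolP (aeval h w != 0); first by exists w.
  have [p hp] := Hn0 h (mem_head _ _).
  have [t /andP[t0 _] Wt] := open_segment p Wo Ww.
  exists (w + t *: (p - w)); split=> //=.
  move: hw; rewrite negbK => /eqP hw.
  by rewrite aeval_line hw subr0 add0r mulf_neq0// gt_eqF.
- by apply: Hn0; rewrite inE kH orbT.
exists v => // k; rewrite inE => /predU1P[->//|]; exact: vH.
Qed.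

Lemma open_positive H : open [set x | forall h, h \in H -> 0 < aeval h x].
Proof.
elim: H => [|h H IH].
  by rewrite (_ : mkset _ = setT); [exact: openT | apply/seteqP; split].
rewrite (_ : mkset _ = [set x | 0 < aeval h x] `&`
  [set x | forall h, h \in H -> 0 < aeval h x]).
  apply: openI => //; apply: (@open_comp _ _ (aeval h) [set r | 0 < r]).
    by move=> x _; exact: aeval_continuous.
  exact: open_gt.
apply/seteqP; split=> x /=.
  by move=> xH; split=> [|k kH]; apply: xH; rewrite inE ?eqxx ?kH ?orbT.
by move=> [xh xH] k; rewrite inE => /predU1P[->//|]; exact: xH.
Qed.

Lemma open_cube z : open [set x : 'rV[R]_d | forall i, z 0 i < x 0 i < z 0 i + 1].
Proof.
pose lo i : 'rV[R]_d * R := (delta_mx 0 i, - z 0 i).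
pose up i : 'rV[R]_d * R := (- delta_mx 0 i, z 0 i + 1).
have loE i x : (0 < aeval (lo i) x) = (z 0 i < x 0 i).
  by rewrite /aeval dot_delta subr_gt0.
have upE i x : (0 < aeval (up i) x) = (x 0 i < z 0 i + 1).
  by rewrite /aeval dotNl dot_delta addrC subr_gt0.
rewrite (_ : mkset _ = [set x | forall h,
    h \in [seq lo i | i : 'I_d] ++ [seq up i | i : 'I_d] -> 0 < aeval h x]).
  exact: open_positive.
apply/seteqP; split=> x /= xP.
  by move=> h; rewrite mem_cat => /orP[|] /mapP[i _ ->];
    rewrite ?loE ?upE; have /andP[] := xP i.
move=> i; rewrite -loE -upE; apply/andP.
by split; apply: xP; rewrite mem_cat map_f ?mem_enum ?orbT.
Qed.

Lemma compact_coord_bounded (K : set 'rV[R]_d) : compact K ->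
  exists N : nat, forall x i, K x -> `|x 0 i| <= N%:R.
Proof.
move=> /compact_bounded[M [_ MK]].
exists (Num.bound `|M + 1|) => x i Kx.
have M1 : M < M + 1 by rewrite ltrDl.
apply: le_trans (_ : `|x| <= _); last first.
  apply: le_trans (MK _ M1 _ Kx) _; exact: le_trans (ler_norm _) (ltW (archi_boundP (normr_ge0 _))).
rewrite [leRHS]/Num.Def.normr /= mx_normrE; apply/bigmax_geP; right => /=.
by exists (0, i).
Qed.

End Pieces.

(** * Lattice translates and the cells of the unit cube *)

Section Tile.
Variables (R : realType) (d : nat).
Implicit Types (x y z : 'rV[R]_d) (K : set 'rV[R]_d).
Implicit Types (h : 'rV[R]_d * R) (H : seq ('rV[R]_d * R)).

Notation cube := (box (0 : 'rV[R]_d) (const_mx 1)).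

Lemma integer_latticeB y z : integer_lattice R d y -> integer_lattice R d z ->
  integer_lattice R d (y - z).
Proof. by move=> yZ zZ i; rewrite !mxE rpredB. Qed.

Lemma cube_dissection K : convex_body K ->
    minkowski_sum K (integer_lattice R d) = setT ->
  exists H, forall s, exists2 z, integer_lattice R d z &
    cube `&` cell H s `<=` [set x | K (x - z)].
Proof.
move=> [_ Kcpt Kcvx] cov.
have [M MK] := compact_coord_bounded Kcpt.
(* If [K + z] meets the cube, the coordinates of [z] are at most [M + 1] in absolute value. *)
pose N := M.+1.
pose J := {ffun 'I_d -> 'I_(N + N).+1}.
pose zJ (j : J) : 'rV[R]_d := \row_i ((j i)%:R - N%:R).
have zJZ j : integer_lattice R d (zJ j).
  by move=> i; rewrite mxE rpredB// natr_int.
have [|||||H HP] := @box_dissected R d J #|[pred i | (0 : 'rV[R]_d) 0 i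
    != (const_mx 1 : 'rV[R]_d) 0 i]|.+1 0 (const_mx 1) (fun j => [set x | K (x - zJ j)]).
- exact: ltnSn.
- move=> j; apply: (@closed_comp _ _ (fun x => x - zJ j) K).
    move=> x _; exact: (@cvgB R 'rV[R]_d _ (nbhs x) (nbhs_filter x) id
      (fun=> zJ j) x (zJ j) cvg_id (cvg_cst _)).
  exact: compact_closed Kcpt.
- move=> j; apply/convex_setP => x y t t0 t1 Kx Ky.
  rewrite /= (_ : _ - zJ j = (x - zJ j) + t *: ((y - zJ j) - (x - zJ j))).
    exact: (convex_setP K).1.
  by rewrite opprB addrA subrK addrAC.
- exact: [ffun=> ord0].
- move=> x x01; have : [set: 'rV[R]_d] x by [].
  rewrite -cov => -[k Kk [z zZ kz]].
  have zN i : exists m : 'I_(N + N).+1, z 0 i = m%:R - N%:R.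
    have /intrP[n zn] := zZ i.
    have ki := MK k i Kk; have := x01 i; rewrite -kz !mxE => kz01.
    have zM : `|n| <= N%:Z.
      rewrite -(ler_int R) intr_norm -zn -[(N%:Z)%:~R]/(N%:R : R) ler_norml.
      move: ki; rewrite ler_norml /N -natr1; lra.
    have [m nm] : exists m : nat, n + N%:Z = m%:Z.
      have : 0 <= n + N%:Z by lia.
      by case: (n + N%:Z) => // m _; exists m.
    exists (inord m); rewrite inordK; last by lia.
    rewrite zn; apply/eqP; rewrite eq_sym subr_eq; apply/eqP.
    by rewrite -[N%:R]/(N%:Z%:~R) -intrD nm.
  have [m mP] := choice zN.
  exists [ffun i => m i] => //=.
  rewrite (_ : zJ _ = z); first by rewrite -kz addrK.
  by apply/rowP => i; rewrite mxE ffunE mP.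
by exists H => s; have [j jP] := HP s; exists (zJ j).
Qed.

Lemma cube_representative x :
  exists2 n, integer_lattice R d n & forall i, n 0 i <= x 0 i < n 0 i + 1.
Proof.
exists (\row_i (Num.floor (x 0 i))%:~R) => i; rewrite mxE; first exact: intr_int.
by have := floor_itv (x 0 i); rewrite intrD1.
Qed.

(** An identically zero form constrains no cell but would rule out generic points. Without
    duplicates, a sign tuple can be read off by index. *)
Lemma nonzero_subfamily H : exists H', [/\ uniq H',
  forall h, h \in H' -> exists x, aeval h x != 0 &
  forall s, cell H' s `<=` cell H s].
Proof.
exists (undup [seq h <- H | `[< exists x, aeval h x != 0 >]]); split.
- exact: undup_uniq.
- by move=> h; rewrite mem_undup mem_filter => /andP[/asboolP].
move=> s x cx h hH; have [hn0|h0] := pselect (exists x, aeval h x != 0).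
  by apply: cx; rewrite mem_undup mem_filter hH andbT; apply/asboolP.
suff -> : aeval h x = 0 by rewrite lexx if_same.
by apply/eqP; rewrite -[_ == _]negbK; apply/negP => hx; apply: h0; exists x.
Qed.

(** Tuples make the sign patterns a finite type; the default only concerns forms outside [H]. *)
Definition signs H (t : (size H).-tuple bool) h := nth false t (index h H).

(** A generic [w] determines its piece: [w - n] is interior to the cube, hence the only cube point
    congruent to [w], and no form vanishes there, so the signs are forced. *)
Lemma cube_piece_generic H (t : (size H).-tuple bool) (z w x n : 'rV[R]_d) :
    integer_lattice R d z -> integer_lattice R d n ->
    (forall i, n 0 i < w 0 i < n 0 i + 1) ->
    (forall h, h \in H -> aeval h (w - n) != 0) ->
    uniq H -> piece 0 (const_mx 1) H (signs t) z x ->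
    integer_lattice R d (w - x) ->
  w - n = x + z /\ t = map_tuple (fun h => 0 < aeval h (w - n)) (in_tuple H).
Proof.
move=> zZ nZ wn wgen Huniq [x01 cx] wxZ.
have wx : w - n = x + z.
  apply/rowP => i; have := x01 i; have := wn i.
  have /intrP[m] : (w 0 i - n 0 i) - (x 0 i + z 0 i) \is a Num.int.
    rewrite opprD addrACA addrA -addrA.
    have := integer_latticeB (integer_latticeB wxZ nZ) zZ i.
    by rewrite !mxE; congr (_ \is a Num.int); ring.
  rewrite !mxE => wxm wn_i x01_i.
  have m1 : (m%:~R : R) < 1 by lra.
  have m0 : (-1 : R) < m%:~R by lra.
  have mE : m = 0.
    move: m1 m0; rewrite -[1]/(1%:~R) -mulrNz !ltr_int; lia.
  by move: wxm; rewrite mE => /eqP; rewrite subr_eq0 => /eqP.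
split=> //; apply: eq_from_tnth => k; rewrite tnth_map.
set h := tnth (in_tuple H) k; have hH : h \in H := mem_tnth k (in_tuple H).
have := cx h hH; have := wgen h hH; rewrite wx.
have -> : signs t h = tnth t k.
  by rewrite /signs /h !(tnth_nth false) (tnth_nth h)/= index_uniq.
by case: ifP => _ h0; [move=> h1; rewrite lt_neqAle eq_sym h0 h1 | move/le_gtF->].
Qed.

End Tile.

(** * Construction and verification of the tile *)

Theorem corollary1p2 (R : realType) (d : nat) (K : set 'rV[R]_d)
    (hK : convex_body K)
    (hcov : minkowski_sum K (integer_lattice R d) = [set: 'rV[R]_d]) :
  exists Omega : set 'rV[R]_d,
    [/\ polytopal Omega, translative_tile Omega & Omega `<=` K].
Proof.
have [H0 H0P] := cube_dissection hK hcov.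
have [H [Huniq Hn0 HH0]] := nonzero_subfamily H0.
have {H0P}/choice[z zP] (t : (size H).-tuple bool) : exists z,
    integer_lattice R d z /\ piece 0 (const_mx 1) H (signs t) z `<=` K.
  have [z zZ zK] := H0P (signs t); exists z; split=> // x [x01 cx].
  by rewrite -(addrK z x); apply: zK; split=> //; exact: HH0.
pose P t := piece 0 (const_mx 1) H (signs t) (z t).
exists (\bigcup_t P t); split; last first.
- by move=> x [t _ /(zP t).2].
- split.
    apply/seteqP; split=> // x _.
    (* Covering: [x] is reduced to the cube point [x - n], whose signs select the piece. *)
    have [n nZ nx] := cube_representative x.
    pose t := map_tuple (fun h => 0 <= aeval h (x - n)) (in_tuple H).
    exists (x - n - z t).
      exists t => //; rewrite /P /piece /= subrK; split.
        by move=> i; have := nx i; rewrite !mxE; lra.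
      move=> h hH; rewrite /signs (nth_map h) ?index_mem// nth_index//.
      by case: ifPn => //; rewrite -ltNge => /ltW.
    exists (z t + n); last by rewrite addrA subrK subrK.
    by move=> i; rewrite mxE rpredD//; exact: (zP t).1.
  (* Disjointness: a common interior point is perturbed to a generic one, which lies over only one
     piece. *)
  move=> y y' yZ y'Z [w0 [w0y w0y']].
  pose W := interior (translate (\bigcup_t P t) y) `&`
            interior (translate (\bigcup_t P t) y').
  have Wo : open W by apply: openI; exact: open_interior.
  have [n nZ nw0] := cube_representative w0.
  (* The target is the centre of the unit cube containing [w0], so the step lands in the open
     cube. *)
  have [r /andP[r0 r1] Wr] := open_segment (n + const_mx 2^-1) Wo (conj w0y w0y').
  have [|||w [Ww wn] wgen] := @generic_point R d
      (W `&` [set x | forall i, n 0 i < x 0 i < n 0 i + 1])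
      [seq shift_form h (- n) | h <- H].
  + by apply: openI => //; exact: open_cube.
  + exists (w0 + r *: (n + const_mx 2^-1 - w0)); split=> // i.
    have := nw0 i; rewrite !mxE => /andP[nw wn1]; apply/andP; split; nra.
  + move=> _ /mapP[h /Hn0[x hx] ->]; exists (x + n).
    by rewrite aeval_shift addrK.
  have {}wgen h : h \in H -> aeval h (w - n) != 0.
    by move=> hH; rewrite -aeval_shift; apply: wgen; exact: map_f.
  have [[x [t _ Px] xw] [x' [t' _ Px'] xw']] :
      translate (\bigcup_t P t) y w /\ translate (\bigcup_t P t) y' w.
    by case: Ww => Wy Wy'; split; exact: interior_subset.
  have [|wx tE] := cube_piece_generic (zP t).1 nZ wn wgen Huniq Px.
    by rewrite -xw addrC addKr.
  have [|wx' t'E] := cube_piece_generic (zP t').1 nZ wn wgen Huniq Px'.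
    by rewrite -xw' addrC addKr.
  (* Equal sign tuples give equal offsets [z t], hence equal points of the tile and equal
     translations. *)
  have xx' : x = x' by apply: (addIr (z t)); rewrite -wx wx' tE -t'E.
  by apply: (addrI x); rewrite xw {1}xx' xw'.
exists (range P); split.
- exact/finite_image/finite_finset.
- by move=> _ [t _ <-]; exact: piece_polytope.
- by rewrite bigcup_image.
Qed.
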